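(* Let $n\ge2$, let $M\in\mathbb{R}^{n\times n}$ be symmetric and nonzero with eigenvalues $m_1,\dots,m_n$ (listed with multiplicity), and assume $A:=I-M$ is invertible. Let $\varrho^{\rm worst}_{\rm AA}$ be the worst-case root-convergence factor of the rAA(1) residual iteration for $M$. Then $$\varrho^{\rm worst}_{\rm AA}\;\ge\;\max_{\substack{i,j\in\{1,\dots,n\}\\ i\neq j}}\left(\frac{|m_im_j(m_j-m_i)|}{|m_i(m_i-1)|+|m_j(m_j-1)|}\right)^{1/2},$$ where a quotient with $m_i=m_j=0$ is interpreted as $0$. Moreover, this holds with equality when $n=2$.
   Context: Let $\langle\cdot,\cdot\rangle$ be the Euclidean inner product and $\|\cdot\|$ the $\ell^2$-norm. With $A:=I-M$ invertible, define for $\mathbf{v}\neq\mathbf{0}$ $$\alpha(\mathbf{v}):=\frac{\langle A\mathbf{v},\mathbf{v}\rangle}{\langle A\mathbf{v},A\mathbf{v}\rangle},\qquad \mathcal{R}(\mathbf{v}):=M\,[I-\alpha(\mathbf{v})A]\,\mathbf{v}.$$ The rAA(1) residual iteration (restarted Anderson acceleration with restart size one for $\mathbf{x}\mapsto M\mathbf{x}+\mathbf{b}$) started from $\mathbf{r}_0$ generates $\mathbf{r}_1,\mathbf{r}_2,\dots$ by $\mathbf{r}_{k+1}=M\mathbf{r}_k$ for $k=0,2,4,\dots$ and $\mathbf{r}_{k+1}=\mathcal{R}(\mathbf{r}_{k-1})$ for $k=1,3,5,\dots$. If some even-indexed residual is $\mathbf{0}$, the exact solution has been found, the iteration is halted,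 and all subsequent residuals are taken to be $\mathbf{0}$. The root-convergence factor is $\varrho(\mathbf{r}_0):=\limsup_{k\to\infty}\|\mathbf{r}_k\|^{1/k}$ (used here whether or not $\mathbf{r}_k\to\mathbf{0}$), and the worst-case root-convergence factor is $\varrho^{\rm worst}:=\sup_{\mathbf{r}_0\in\mathbb{R}^n\setminus\{\mathbf{0}\}}\varrho(\mathbf{r}_0)$. *)

(* Defs.v *)
From HB Require Import structures.
From mathcomp Require Export all_boot all_order all_algebra.
From mathcomp Require Export all_classical all_reals all_analysis.

Set Implicit Arguments.
Unset Strict Implicit.
Unset Printing Implicit Defensive.

Import Order.TTheory GRing.Theory Num.Theory.

Local Open Scope ring_scope.

Section RestartedAnderson.
Variables (R : realType) (n : nat).
Implicit Types (u v : 'cV[R]_n) (M : 'M[R]_n) (m : 'I_n -> R).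

Definition dot u v : R := \sum_i u i 0 * v i 0.

(* The library norm `|v| on matrices is the sup norm, hence this definition. *)
Definition l2norm v : R := Num.sqrt (dot v v).

Definition raa_alpha M v : R :=
  let A := 1%:M - M in dot (A *m v) v / dot (A *m v) (A *m v).

Definition raa_map M v : 'cV[R]_n :=
  M *m (1%:M - raa_alpha M v *: (1%:M - M)) *m v.

(* Both M *m _ and raa_map M send 0 to 0, so once an even-indexed residual
   vanishes all later ones do: the halting convention needs no separate case. *)
Lemma raa_map0 M : raa_map M 0 = 0.
Proof. by rewrite /raa_map mulmx0. Qed.

Fixpoint raa_residual M (r0 : 'cV[R]_n) (k : nat) : 'cV[R]_n :=
  match k with
  | 0 => r0
  | 1 => M *m r0
  | (k'.+1 as k1).+1 =>
      if odd k1 then raa_map M (raa_residual M r0 k')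
      else M *m raa_residual M r0 k1
  end.

(* Extended-real valued, so that the limsup and the supremum below exist
   without a boundedness proof. The k = 0 term is irrelevant to the limsup. *)
Definition root_conv_factor M (r0 : 'cV[R]_n) : \bar R :=
  limn_esup (fun k => (l2norm (raa_residual M r0 k) `^ k%:R^-1)%:E).

Definition worst_root_conv_factor M : \bar R :=
  ereal_sup [set root_conv_factor M r0 | r0 in [set r : 'cV[R]_n | r != 0]].

(* m lists the eigenvalues of M with (algebraic) multiplicity. *)
Definition eigenvalues_of M m : Prop :=
  char_poly M = \prod_(i < n) ('X - (m i)%:P).

(* Division by 0 yields 0, which covers the case a = b = 0. *)
Definition pair_factor (a b : R) : R :=
  Num.sqrt (`|a * b * (b - a)| / (`|a * (a - 1)| + `|b * (b - 1)|)).

(* All pair factors are >= 0, so the default value 0 does not affect the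
   maximum as soon as a pair i != j exists. *)
Definition max_pair_factor m : R :=
  \big[Num.max/0]_(p : 'I_n * 'I_n | p.1 != p.2) pair_factor (m p.1) (m p.2).

End RestartedAnderson.

(* Main.v *)
Require Import Defs.
From mathcomp Require Import ring.
Import Order.TTheory GRing.Theory Num.Theory.
Import numFieldNormedType.Exports.
Local Open Scope classical_set_scope.
Local Open Scope ring_scope.

Set Implicit Arguments.
Unset Strict Implicit.
Unset Printing Implicit Defensive.

(** The iteration can be solved exactly on a sum of two orthogonal eigenvectors.
Let [M p = a p], [M q = b q] and [dot p q = 0], with squared norms [s] of [p]
and [t] of [q], and let [D = (1 - a)^2 s + (1 - b)^2 t].  Writing
[T] for [raa_map M],
[[
  T (p + q) = (a - b) / D * (a (1 - b) t p - b (1 - a) s q),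
]]
which again lies in the span of [p] and [q].  Applying the formula twice, the
coefficients of [p] and [q] become equal: [T (T (p + q)) = lambda (p + q)]
with
[[
  lambda = (a b (b - a))^2 s t / (D (a^2 t + b^2 s)).
]]
Since [T] is homogeneous of degree one, the residuals satisfy
[r_(k+4) = lambda r_k] for every [k], so the root-convergence factor of
[p + q] is exactly [lambda ^ (1/4)] ([root_conv_factor_two_modes]).

It remains to maximise [lambda] over [s] and [t].  By the inequality between
arithmetic and geometric means, [D (a^2 t + b^2 s)] is at least
[(|a (1 - a)| + |b (1 - b)|)^2 s t], with equality when
[|1 - a| |b| s = |1 - b| |a| t].  Hence [lambda] is at most the fourth power
of the pair factor of [a] and [b] ([two_mode_factor_le]), and the bound is
attained by a suitable scaling of [p] and [q] ([two_mode_factor_balanced]).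

For the lower bound, eigenvectors for two distinct eigenvalues of a symmetric
matrix are orthogonal, so every nonzero pair factor is the root-convergence
factor of some starting residual ([pair_factor_le_worst]); a zero pair factor
is trivially a lower bound.  For [n = 2], Cayley-Hamilton splits every vector
into two orthogonal modes ([two_mode_splitting]), so the two-mode bound covers
every starting residual. *)

(** * Root growth of sequences with a multiplicative recurrence *)

Lemma cvg_root_const (R : realType) (C : R) :
  0 < C -> C `^ k%:R^-1 @[k --> \oo] --> (1 : R).
Proof.
move=> C_gt0; rewrite -cvg_shiftS.
have -> : (fun k => C `^ k.+1%:R^-1) = expR \o (fun k => harmonic k * ln C).
  by apply/funext => k /=; rewrite /powR gt_eqF.
have eC : (fun k => harmonic k * ln C) @ \oo --> 0 * ln C.
  by apply: cvgM; [exact: cvg_harmonic|exact: cvg_cst].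
have := cvg_comp _ _ eC (@continuous_expR R (0 * ln C)).
by rewrite mul0r; rewrite expR0.
Qed.

Lemma root_pow_mul (R : realType) (C F : R) (k : nat) :
  0 <= C -> 0 <= F -> (0 < k)%N ->
  (C * F ^+ k) `^ k%:R^-1 = C `^ k%:R^-1 * F.
Proof.
move=> C_ge0 F_ge0 k_gt0.
rewrite powRM ?exprn_ge0// -powR_mulrn// -powRrM mulfV ?powRr1//.
by rewrite pnatr_eq0 -lt0n.
Qed.

Lemma cvg_root_pow_mul (R : realType) (C F : R) :
  0 < C -> (C `^ k%:R^-1 * F) @[k --> \oo] --> F.
Proof.
move=> C_gt0; rewrite -[X in _ --> X]mul1r.
by apply: cvgM; [exact: cvg_root_const|exact: cvg_cst].
Qed.

(** An eventual bound up to every positive error suffices, so convergence of a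
majorant is enough. *)
Lemma limn_esup_le (R : realType) (u : nat -> R) (l : R) :
  (forall e, 0 < e -> \forall k \near \oo, u k <= l + e) ->
  (limn_esup (fun k => (u k)%:E) <= l%:E)%E.
Proof.
move=> ul; apply/lee_addgt0Pr => e e_gt0.
have [N _ uN] := ul e e_gt0.
apply: ge_ereal_inf.
exists (ereal_sup [set (u k)%:E | k in [set k | (N <= k)%N]]).
  by exists [set k | (N <= k)%N] => //; exists N.
by apply: ge_ereal_sup => _ [k Nk <-]; rewrite -EFinD lee_fin; exact: uN.
Qed.

(** Only infinitely many terms have to be large, so a subsequence is enough. *)
Lemma limn_esup_ge (R : realType) (u : nat -> R) (l : R) :
  (forall e, 0 < e -> forall N, exists2 k, (N <= k)%N & l - e <= u k) ->
  (l%:E <= limn_esup (fun k => (u k)%:E))%E.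
Proof.
move=> ul; apply/lee_subgt0Pr => e e_gt0.
apply: le_ereal_inf_tmp => _ [V [N _ NV] <-].
have [k Nk uk] := ul e e_gt0 N.
apply: (@le_trans _ _ (u k)%:E); first by rewrite -EFinB lee_fin.
by apply: ereal_sup_ubound; exists k => //; exact: NV.
Qed.

Section PeriodicGrowth.
Variables (R : realType) (x : nat -> R) (d : nat) (F : R).
Hypotheses (d_gt0 : (0 < d)%N) (F_ge0 : 0 <= F) (x_ge0 : forall k, 0 <= x k).

(** Dividing by [F ^+ k] turns the hypothesis into [y (k + d) <= y k], so the
quotients are bounded by their first [d] values.  For [F = 0] the sequence
vanishes from index [d] on, which is why the bound starts there. *)
Lemma periodic_le_geometric : (forall k, x (k + d) <= F ^+ d * x k) ->
  exists2 C, 0 < C & forall k, (d <= k)%N -> x k <= C * F ^+ k.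
Proof.
move=> xd; have [F0|F_neq0] := eqVneq F 0.
  exists 1 => // k dk; have := xd (k - d)%N.
  by rewrite subnK// F0 !expr0n !gtn_eqF ?(leq_trans d_gt0)// mul0r mulr0.
have F_gt0 : 0 < F by rewrite lt_def F_neq0.
pose S := \sum_(j < d) x j / F ^+ j.
have term_ge0 (j : nat) : 0 <= x j / F ^+ j by rewrite divr_ge0 ?exprn_ge0.
have S_ge0 : 0 <= S by apply: sumr_ge0.
(* The summand 1 only serves to make the constant positive. *)
exists (1 + S); first by rewrite ltr_pwDl.
move=> k _; elim/ltn_ind: k => k IHk.
have [kd|dk] := ltnP k d.
  rewrite -ler_pdivrMr ?exprn_gt0// /S (bigD1 (Ordinal kd))//=.
  rewrite addrCA lerDl addr_ge0// sumr_ge0//.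
rewrite -{1}(subnK dk); apply: (le_trans (xd _)).
rewrite -{2}(subnKC dk) exprD mulrCA ler_wpM2l ?exprn_ge0//.
by apply: IHk; rewrite ltn_subrL d_gt0 (leq_trans d_gt0).
Qed.

(** The constant of the geometric bound disappears under the [k]-th root. *)
Lemma limn_esup_root_le : (forall k, x (k + d) <= F ^+ d * x k) ->
  (limn_esup (fun k => (x k `^ k%:R^-1)%:E) <= F%:E)%E.
Proof.
move=> /periodic_le_geometric[C C_gt0 xC]; apply: limn_esup_le => e e_gt0.
near=> k.
have dk : (d <= k)%N by near: k; exact: nbhs_infty_ge.
apply: (@le_trans _ _ (C `^ k%:R^-1 * F)).
  rewrite -(root_pow_mul (ltW C_gt0))// ?(leq_trans d_gt0)//.
  by rewrite ge0_ler_powR ?nnegrE ?mulr_ge0 ?exprn_ge0 ?(ltW C_gt0) ?xC.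
near: k; apply: (cvgr_le F); first exact: cvg_root_pow_mul.
by rewrite ltrDl.
Unshelve. all: by end_near. Qed.

(** The multiples of [d] are a subsequence that grows at least like [F ^+ k]. *)
Lemma limn_esup_root_ge : 0 < x 0 -> (forall k, F ^+ d * x k <= x (k + d)) ->
  (F%:E <= limn_esup (fun k => (x k `^ k%:R^-1)%:E))%E.
Proof.
move=> x0_gt0 xd.
have x_ge k : x 0 * F ^+ (k * d) <= x (k * d)%N.
  elim: k => [|k IHk]; first by rewrite mul0n mulr1.
  rewrite mulSn addnC; apply: le_trans (xd _).
  by rewrite exprD mulrA mulrC ler_wpM2l ?exprn_ge0.
apply: limn_esup_ge => e e_gt0 N.
have [K _ HK] : \forall k \near \oo, F - e <= x 0 `^ k%:R^-1 * F.
  by apply: (cvgr_ge F); [exact: cvg_root_pow_mul|rewrite ltrBlDr ltrDl].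
pose k := (maxn K N).+1.
have k_le : (k <= k * d)%N by rewrite leq_pmulr.
have Kk : (K <= k * d)%N by rewrite (leq_trans _ k_le)// leqW// leq_maxl.
exists (k * d)%N; first by rewrite (leq_trans _ k_le)// leqW// leq_maxr.
apply: (le_trans (HK _ Kk)).
rewrite -root_pow_mul// ?(ltW x0_gt0)// ?muln_gt0//.
by rewrite ge0_ler_powR ?nnegrE ?mulr_ge0 ?exprn_ge0 ?(ltW x0_gt0).
Qed.

End PeriodicGrowth.

(** * The Euclidean inner product and the residual iteration *)

Section Dot.
Variables (R : realType) (n : nat).
Implicit Types (u v w : 'cV[R]_n) (c : R) (M : 'M[R]_n).

Lemma dotE u v : dot u v = (u^T *m v) 0 0.
Proof. by rewrite mxE; apply: eq_bigr => i _; rewrite mxE. Qed.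

Lemma dotC u v : dot u v = dot v u.
Proof. by apply: eq_bigr => i _; rewrite mulrC. Qed.

Lemma dotDl u v w : dot (u + v) w = dot u w + dot v w.
Proof. by rewrite !dotE linearD mulmxDl mxE. Qed.

Lemma dotDr u v w : dot u (v + w) = dot u v + dot u w.
Proof. by rewrite !dotE mulmxDr mxE. Qed.

Lemma dotZl c u v : dot (c *: u) v = c * dot u v.
Proof. by rewrite !dotE linearZ -scalemxAl mxE. Qed.

Lemma dotZr c u v : dot u (c *: v) = c * dot u v.
Proof. by rewrite dotC dotZl dotC. Qed.

Lemma dot_ge0 v : 0 <= dot v v.
Proof. by apply: sumr_ge0 => i _; rewrite -expr2 sqr_ge0. Qed.

Lemma dot_eq0 v : (dot v v == 0) = (v == 0).
Proof.
rewrite /dot psumr_eq0; last by move=> i _; rewrite -expr2 sqr_ge0.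
apply/allP/eqP => [v0|-> i _]; last by move=> /=; rewrite mxE mul0r eqxx.
apply/colP => i; rewrite mxE; apply/eqP.
by have := v0 i (mem_index_enum i); rewrite mulf_eq0 orbb.
Qed.

Lemma dot_gt0 v : (0 < dot v v) = (v != 0).
Proof. by rewrite lt_def dot_ge0 andbT dot_eq0. Qed.

Lemma dot_mulmxl M u v : M^T = M -> dot (M *m u) v = dot u (M *m v).
Proof. by move=> M_sym; rewrite !dotE trmx_mul M_sym mulmxA. Qed.

Lemma l2normZ c v : l2norm (c *: v) = `|c| * l2norm v.
Proof.
by rewrite /l2norm dotZl dotZr mulrA -expr2 sqrtrM ?sqr_ge0// sqrtr_sqr.
Qed.

(** Evaluate [dot (M *m u) v] on both sides of the symmetry of [M]. *)
Lemma eigenvector_orthogonal M (a b : R) u v : M^T = M -> a != b ->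
  M *m u = a *: u -> M *m v = b *: v -> dot u v = 0.
Proof.
move=> M_sym ab Mu Mv; apply/eqP.
have := dot_mulmxl u v M_sym; rewrite Mu Mv dotZl dotZr => /eqP.
by rewrite -subr_eq0 -mulrBl mulf_eq0 subr_eq0 (negPf ab).
Qed.

(** The step length [raa_alpha] is a quotient of two quadratic forms, hence
invariant under scaling. *)
Lemma raa_mapZ M c v : raa_map M (c *: v) = c *: raa_map M v.
Proof.
have [->|c_neq0] := eqVneq c 0; first by rewrite !scale0r raa_map0.
suff alphaZ : raa_alpha M (c *: v) = raa_alpha M v.
  by rewrite /raa_map alphaZ -scalemxAr.
rewrite /raa_alpha /= -scalemxAr !dotZl !dotZr !mulrA.
by rewrite -mulf_div divff ?mul1r// mulf_neq0.
Qed.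

Lemma raa_residual_even M v k : raa_residual M v k.*2 = iter k (raa_map M) v.
Proof.
elim: k => // k IHk; rewrite doubleS /= -IHk.
by case: k {IHk} => //= k; rewrite odd_double.
Qed.

Lemma raa_residual_odd M v k :
  raa_residual M v k.*2.+1 = M *m iter k (raa_map M) v.
Proof.
rewrite -raa_residual_even; case: k => // k.
by rewrite doubleS /= odd_double.
Qed.

(** Two steps of the iteration apply [raa_map] once, hence the period 4; the
factor [c] propagates because [raa_map] is homogeneous. *)
Lemma raa_residual_period4 M v c :
    raa_map M (raa_map M v) = c *: v ->
  forall k, raa_residual M v (k + 4) = c *: raa_residual M v k.
Proof.
move=> RRv k.
have iterP j : iter j.+2 (raa_map M) v = c *: iter j (raa_map M) v.
  rewrite -addn2 iterD /= RRv; elim: j => // j IHj.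
  by rewrite !iterS IHj raa_mapZ.
have add4 j : (j.*2 + 4)%N = j.+2.*2 by rewrite !doubleS !addnS addn0.
have := odd_double_half k.
case: (odd k) => <-; rewrite ?add1n ?add0n ?addSn add4.
  by rewrite !raa_residual_odd iterP scalemxAr.
by rewrite !raa_residual_even iterP.
Qed.

End Dot.

(** * The iteration on two orthogonal eigenvectors *)

(** The factor [lambda] by which two applications of [raa_map] scale a sum of
orthogonal eigenvectors with eigenvalues [a], [b] and squared norms [s], [t]. *)
Definition two_mode_factor (R : realType) (a b s t : R) : R :=
  (a * b * (b - a)) ^+ 2 * s * t /
  (((1 - a) ^+ 2 * s + (1 - b) ^+ 2 * t) * (a ^+ 2 * t + b ^+ 2 * s)).

Section TwoModes.
Variables (R : realType) (n : nat) (M : 'M[R]_n) (a b : R).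
Hypotheses (a_neq1 : 1 - a != 0) (b_neq1 : 1 - b != 0).

Lemma weighted_sum_eq0 (s t : R) : 0 <= s -> 0 <= t ->
  ((1 - a) ^+ 2 * s + (1 - b) ^+ 2 * t == 0) = (s == 0) && (t == 0).
Proof.
move=> s_ge0 t_ge0.
have sqr_mul_eq0 (c w : R) : 1 - c != 0 -> ((1 - c) ^+ 2 * w == 0) = (w == 0).
  by move=> c_neq1; rewrite mulf_eq0 expf_eq0 /= (negPf c_neq1).
by rewrite paddr_eq0 ?(mulr_ge0 (sqr_ge0 _))// !sqr_mul_eq0.
Qed.

(** With [alpha = ((1 - a) s + (1 - b) t) / D], the factor [1 - alpha (1 - a)]
equals [(a - b) (1 - b) t / D], and symmetrically for [b].  If [D] is zero then
both vectors vanish, and so do both sides. *)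
Lemma raa_map_two_modes (p q : 'cV[R]_n) :
    M *m p = a *: p -> M *m q = b *: q -> dot p q = 0 ->
  let s := dot p p in let t := dot q q in
  let D := (1 - a) ^+ 2 * s + (1 - b) ^+ 2 * t in
  raa_map M (p + q) =
    (a * (a - b) * (1 - b) * t / D) *: p + (b * (b - a) * (1 - a) * s / D) *: q.
Proof.
move=> Mp Mq pq s t D.
have Ap : (1%:M - M) *m p = (1 - a) *: p.
  by rewrite mulmxBl mul1mx Mp scalerBl scale1r.
have Aq : (1%:M - M) *m q = (1 - b) *: q.
  by rewrite mulmxBl mul1mx Mq scalerBl scale1r.
have qp : dot q p = 0 by rewrite dotC.
have [D0|D_neq0] := eqVneq D 0.
  have /andP[p0 q0] : (s == 0) && (t == 0).
    by rewrite -weighted_sum_eq0 ?dot_ge0//; apply/eqP.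
  rewrite !dot_eq0 in p0 q0; rewrite (eqP p0) (eqP q0).
  by rewrite !scaler0 addr0 raa_map0.
have alphaE : raa_alpha M (p + q) = ((1 - a) * s + (1 - b) * t) / D.
  rewrite /raa_alpha /= mulmxDr Ap Aq !(dotDl, dotDr) !(dotZl, dotZr) pq qp.
  by rewrite -/s -/t !mulr0 !addr0 !add0r !mulrA -!expr2.
rewrite /raa_map alphaE -mulmxA mulmxBl mul1mx -scalemxAl.
rewrite [(1%:M - M) *m _]mulmxDr Ap Aq.
set al := (_ / D).
have -> : p + q - al *: ((1 - a) *: p + (1 - b) *: q) =
    (1 - al * (1 - a)) *: p + (1 - al * (1 - b)) *: q.
  by rewrite scalerDr !scalerA opprD addrACA !scalerBl !scale1r.
have -> : 1 - al * (1 - a) = (a - b) * (1 - b) * t / D by rewrite /al /D; field.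
have -> : 1 - al * (1 - b) = (b - a) * (1 - a) * s / D by rewrite /al /D; field.
rewrite mulmxDr -!scalemxAr Mp Mq !scalerA.
by congr (_ *: _ + _ *: _); ring.
Qed.

(** The scalar computation behind two applications of [raa_map]: [x] and [y] are
the coefficients after the first one, and the left-hand sides those after the
second.  The point is that they agree, although [x] and [y] differ. *)
Lemma two_mode_coef (s t : R) : 0 <= s -> 0 <= t ->
  let D := (1 - a) ^+ 2 * s + (1 - b) ^+ 2 * t in
  let x := a * (a - b) * (1 - b) * t / D in
  let y := b * (b - a) * (1 - a) * s / D in
  let D' := (1 - a) ^+ 2 * (x ^+ 2 * s) + (1 - b) ^+ 2 * (y ^+ 2 * t) in
  (a * (a - b) * (1 - b) * (y ^+ 2 * t) / D' * x = two_mode_factor a b s t) *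
  (b * (b - a) * (1 - a) * (x ^+ 2 * s) / D' * y = two_mode_factor a b s t).
Proof.
move=> s_ge0 t_ge0 D x y D'.
(* In the degenerate case some denominators may vanish, but both sides are 0. *)
have [N0|] := eqVneq (a * b * (b - a) * s * t) 0.
  have xy0 : x * y = 0.
    have -> : x * y = - (a * b * (b - a) * s * t) *
        (b - a) * (1 - a) * (1 - b) / D / D by rewrite /x /y; ring.
    by rewrite N0 oppr0 !mul0r.
  have -> : two_mode_factor a b s t = 0.
    rewrite /two_mode_factor.
    have -> : (a * b * (b - a)) ^+ 2 * s * t =
        (a * b * (b - a) * s * t) * (a * b * (b - a)) by ring.
    by rewrite N0 !mul0r.
  split.
    have -> : a * (a - b) * (1 - b) * (y ^+ 2 * t) / D' * x =
        (x * y) * (a * (a - b) * (1 - b) * y * t / D') by ring.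
    by rewrite xy0 mul0r.
  have -> : b * (b - a) * (1 - a) * (x ^+ 2 * s) / D' * y =
      (x * y) * (b * (b - a) * (1 - a) * x * s / D') by ring.
  by rewrite xy0 mul0r.
rewrite !mulf_eq0 !negb_or subr_eq0.
move=> /andP[/andP[/andP[/andP[a0 b0] ba] s0] t0].
have s_gt0 : 0 < s by rewrite lt_def s0.
have t_gt0 : 0 < t by rewrite lt_def t0.
have E_neq0 : a ^+ 2 * t + b ^+ 2 * s != 0.
  by rewrite gt_eqF// addr_gt0// mulr_gt0// exprn_even_gt0.
have D_neq0 : D != 0 by rewrite weighted_sum_eq0// negb_and s0.
have D'E : D' = ((b - a) * (1 - a) * (1 - b) / D) ^+ 2 * s * t *
    (a ^+ 2 * t + b ^+ 2 * s).
  by rewrite /D' /x /y; field.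
rewrite D'E /two_mode_factor -/D /x /y.
have ba0 : b - a != 0 by rewrite subr_eq0.
by split; field; rewrite ?a_neq1 ?b_neq1 ?s0 ?t0 ?ba0 ?D_neq0 ?E_neq0.
Qed.

End TwoModes.

Section ConvFactor.
Variables (R : realType) (n : nat) (M : 'M[R]_n) (a b : R).
Hypotheses (a_neq1 : 1 - a != 0) (b_neq1 : 1 - b != 0).
Variables (p q : 'cV[R]_n).
Hypotheses (Mp : M *m p = a *: p) (Mq : M *m q = b *: q) (pq : dot p q = 0).

Let lambda := two_mode_factor a b (dot p p) (dot q q).

Lemma raa_map_twice_two_modes :
  raa_map M (raa_map M (p + q)) = lambda *: (p + q).
Proof.
rewrite (raa_map_two_modes a_neq1 b_neq1 Mp Mq pq) /=.
set x := (_ / _); set y := (_ / _).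
have Mxp : M *m (x *: p) = a *: (x *: p).
  by rewrite -scalemxAr Mp !scalerA mulrC.
have Myq : M *m (y *: q) = b *: (y *: q).
  by rewrite -scalemxAr Mq !scalerA mulrC.
have xpyq : dot (x *: p) (y *: q) = 0 by rewrite dotZl dotZr pq !mulr0.
rewrite (raa_map_two_modes a_neq1 b_neq1 Mxp Myq xpyq) /=.
rewrite !(dotZl, dotZr) !(mulrA x x, mulrA y y) -!expr2 !scalerA scalerDr.
have [cp cq] := two_mode_coef a_neq1 b_neq1 (dot_ge0 p) (dot_ge0 q).
by congr (_ *: _ + _ *: _).
Qed.

Lemma two_mode_factor_ge0 (s t : R) : 0 <= s -> 0 <= t ->
  0 <= two_mode_factor a b s t.
Proof.
move=> s_ge0 t_ge0; apply: divr_ge0.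
  by rewrite -mulrA (mulr_ge0 (sqr_ge0 _))// mulr_ge0.
by rewrite mulr_ge0// addr_ge0// (mulr_ge0 (sqr_ge0 _)).
Qed.

(** The residual norms satisfy the exact recurrence [x (k + 4) = F ^+ 4 * x k]
with [F ^+ 4 = lambda], so both growth estimates apply. *)
Lemma root_conv_factor_two_modes : p + q != 0 ->
  root_conv_factor M (p + q) = (Num.sqrt (Num.sqrt lambda))%:E.
Proof.
move=> pq_neq0.
have lambda_ge0 : 0 <= lambda by rewrite two_mode_factor_ge0 ?dot_ge0.
pose F : R := Num.sqrt (Num.sqrt lambda); rewrite -/F.
have F_ge0 : 0 <= F by rewrite sqrtr_ge0.
have F4 : F ^+ 4 = lambda.
  by rewrite -[4%N]/(2 * 2)%N exprM !sqr_sqrtr ?sqrtr_ge0.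
have normS k : l2norm (raa_residual M (p + q) (k + 4)) =
    F ^+ 4 * l2norm (raa_residual M (p + q) k).
  rewrite (raa_residual_period4 raa_map_twice_two_modes).
  by rewrite l2normZ ger0_norm ?F4.
have norm_ge0 k : 0 <= l2norm (raa_residual M (p + q) k) by rewrite sqrtr_ge0.
apply/eqP; rewrite eq_le; apply/andP; split.
  by apply: (limn_esup_root_le (d := 4)) => // k; rewrite normS.
apply: (limn_esup_root_ge (d := 4)) => // [|k]; last by rewrite normS.
by rewrite /= sqrtr_gt0 dot_gt0.
Qed.

End ConvFactor.

(** * Extremal weights of the two eigenvectors *)

Section PairFactor.
Variables (R : realType) (a b : R).
Hypotheses (a_neq1 : 1 - a != 0) (b_neq1 : 1 - b != 0).

Let Q := `|a * b * (b - a)| / (`|a * (a - 1)| + `|b * (b - 1)|).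

(** After clearing denominators the difference of the two sides is the square of
[|1 - a| |b| s - |1 - b| |a| t]. *)
Lemma two_mode_factor_le (s t : R) : 0 <= s -> 0 <= t ->
  two_mode_factor a b s t <= Q ^+ 2.
Proof.
move=> s_ge0 t_ge0.
have [N0|] := eqVneq (a * b * (b - a) * s * t) 0.
  rewrite /two_mode_factor.
  have -> : (a * b * (b - a)) ^+ 2 * s * t =
      (a * b * (b - a) * s * t) * (a * b * (b - a)) by ring.
  by rewrite N0 !mul0r sqr_ge0.
rewrite !mulf_eq0 !negb_or subr_eq0.
move=> /andP[/andP[/andP[/andP[a0 b0] ba] s0] t0].
have s_gt0 : 0 < s by rewrite lt_def s0.
have t_gt0 : 0 < t by rewrite lt_def t0.
rewrite /Q expr_div_n real_normK ?num_real// /two_mode_factor.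
rewrite -[_ * s * t]mulrA -[_ * (s * t) / _]mulrA ler_wpM2l ?sqr_ge0//.
have sqr_gt0 (c : R) : c != 0 -> 0 < c ^+ 2.
  by move=> c0; rewrite exprn_even_gt0.
have D_gt0 : 0 < (1 - a) ^+ 2 * s + (1 - b) ^+ 2 * t.
  by rewrite addr_gt0// mulr_gt0// sqr_gt0.
have E_gt0 : 0 < a ^+ 2 * t + b ^+ 2 * s.
  by rewrite addr_gt0// mulr_gt0// sqr_gt0.
have U_gt0 : 0 < `|a * (a - 1)|.
  by rewrite normr_gt0 mulf_neq0// -opprB oppr_eq0.
have V_gt0 : 0 < `|b * (b - 1)|.
  by rewrite normr_gt0 mulf_neq0// -opprB oppr_eq0.
rewrite ler_pdivrMr ?mulr_gt0// [leRHS]mulrC ler_pdivlMr ?exprn_gt0 ?addr_gt0//.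
rewrite [(`|_| + _) ^+ 2]sqrrD !real_normK ?num_real// -subr_ge0.
have := sqr_ge0 (`|1 - a| * `|b| * s - `|1 - b| * `|a| * t).
have -> : (`|1 - a| * `|b| * s - `|1 - b| * `|a| * t) ^+ 2 =
    `|1 - a| ^+ 2 * `|b| ^+ 2 * s ^+ 2 + `|1 - b| ^+ 2 * `|a| ^+ 2 * t ^+ 2 -
    2 * (`|a| * `|1 - a| * (`|b| * `|1 - b|)) * s * t by ring.
rewrite !real_normK ?num_real// !normrM (distrC a) (distrC b).
by congr (0 <= _); ring.
Qed.

(** These weights make [|1 - a| |b| s - |1 - b| |a| t] vanish, which is the
equality case of the previous bound. *)
Lemma two_mode_factor_balanced : a != 0 -> b != 0 ->
  two_mode_factor a b `|(1 - b) * a| `|(1 - a) * b| = Q ^+ 2.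
Proof.
move=> a0 b0.
have sqrN (c : R) : c ^+ 2 = `|c| ^+ 2 by rewrite real_normK ?num_real.
rewrite /Q expr_div_n real_normK ?num_real// /two_mode_factor.
rewrite -[_ * `|_| * `|_|]mulrA -[_ ^+ 2 * (_ * _) / _]mulrA; congr (_ * _).
rewrite (sqrN (1 - a)) (sqrN (1 - b)) (sqrN a) (sqrN b).
rewrite !normrM (distrC a) (distrC b).
move: a_neq1 b_neq1 a0 b0; rewrite -!normr_gt0.
move: `|1 - a| `|1 - b| `|a| `|b| => x y z w x0 y0 z0 w0.
have zx := mulr_gt0 z0 x0; have wy := mulr_gt0 w0 y0.
have xyz : 0 < x ^+ 2 * (y * z) + y ^+ 2 * (x * w).
  by rewrite addr_gt0// mulr_gt0 ?mulr_gt0.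
have xyw : 0 < z ^+ 2 * (x * w) + w ^+ 2 * (y * z).
  by rewrite addr_gt0// mulr_gt0 ?mulr_gt0.
by field; rewrite (gt_eqF xyz) (gt_eqF xyw) gt_eqF ?addr_gt0.
Qed.

End PairFactor.

(** * Worst-case convergence factor *)

Section Spectrum.
Variables (R : realType) (n : nat) (M : 'M[R]_n) (m : 'I_n -> R).
Hypotheses (M_sym : M^T = M) (m_eig : eigenvalues_of M m).

(** Roots of the characteristic polynomial yield row eigenvectors; symmetry of
[M] turns them into columns. *)
Lemma eigenvector_of i : exists2 v : 'cV[R]_n, v != 0 & M *m v = m i *: v.
Proof.
have : eigenvalue M (m i).
  rewrite eigenvalue_root_char m_eig rootE horner_prod.
  by rewrite (bigD1 i)//= hornerXsubC subrr mul0r.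
move=> /eigenvalueP[u uM u_neq0]; exists u^T; first by rewrite trmx_eq0.
by rewrite -{1}M_sym -trmx_mul uM linearZ.
Qed.

Lemma eigenvalue_neq1 i : 1%:M - M \in unitmx -> 1 - m i != 0.
Proof.
move=> A_inv; have [v v_neq0 Mv] := eigenvector_of i.
apply: contra v_neq0 => /eqP mi1.
have Av : (1%:M - M) *m v = 0.
  by rewrite mulmxBl mul1mx Mv -{1}[v]scale1r -scalerBl mi1 scale0r.
by rewrite -(mulKmx A_inv v) Av mulmx0.
Qed.

End Spectrum.

Lemma root_conv_factor_ge0 (R : realType) n (M : 'M[R]_n) r :
  (0%:E <= root_conv_factor M r)%E.
Proof.
apply: limn_esup_ge => e e_gt0 N; exists N => //.
by rewrite sub0r (le_trans _ (powR_ge0 _ _))// oppr_le0 ltW.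
Qed.

Lemma root_conv_factor_le_worst (R : realType) n (M : 'M[R]_n) r : r != 0 ->
  (root_conv_factor M r <= worst_root_conv_factor M)%E.
Proof. by move=> r_neq0; apply: ereal_sup_ubound; exists r. Qed.

(** When the pair factor is nonzero, the two eigenvalues differ and are nonzero;
orthogonal eigenvectors scaled to the balanced weights then reach it. *)
Lemma pair_factor_le_worst (R : realType) (n : nat) (M : 'M[R]_n)
    (m : 'I_n -> R) (i j : 'I_n) :
    M^T = M -> eigenvalues_of M m -> 1%:M - M \in unitmx ->
  ((pair_factor (m i) (m j))%:E <= worst_root_conv_factor M)%E.
Proof.
move=> M_sym m_eig A_inv.
have a_neq1 := eigenvalue_neq1 M_sym m_eig i A_inv.
have b_neq1 := eigenvalue_neq1 M_sym m_eig j A_inv.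
have [u u_neq0 Mu] := eigenvector_of M_sym m_eig i.
have [v v_neq0 Mv] := eigenvector_of M_sym m_eig j.
have [N0|] := eqVneq (m i * m j * (m j - m i)) 0.
  rewrite /pair_factor N0 normr0 mul0r sqrtr0.
  apply: le_trans (root_conv_factor_le_worst M u_neq0).
  exact: root_conv_factor_ge0.
rewrite !mulf_eq0 !negb_or => /andP[/andP[a0 b0]].
rewrite subr_eq0 eq_sym => ab.
have uv := eigenvector_orthogonal M_sym ab Mu Mv.
have scale_norm (w : 'cV[R]_n) (c : R) : w != 0 -> 0 <= c ->
    dot (Num.sqrt (c / dot w w) *: w) (Num.sqrt (c / dot w w) *: w) = c.
  move=> w_neq0 c_ge0; rewrite dotZl dotZr mulrA -expr2 sqr_sqrtr.
    by rewrite mulfVK// dot_eq0.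
  by rewrite divr_ge0// dot_ge0.
set a := m i in a_neq1 a0 ab Mu *; set b := m j in b_neq1 b0 ab Mv *.
pose s : R := `|(1 - b) * a|; pose t : R := `|(1 - a) * b|.
pose p := Num.sqrt (s / dot u u) *: u; pose q := Num.sqrt (t / dot v v) *: v.
have Mp : M *m p = a *: p by rewrite -scalemxAr Mu !scalerA mulrC.
have Mq : M *m q = b *: q by rewrite -scalemxAr Mv !scalerA mulrC.
have pp : dot p p = s by rewrite scale_norm // normr_ge0.
have qq : dot q q = t by rewrite scale_norm // normr_ge0.
have pq : dot p q = 0 by rewrite dotZl dotZr uv !mulr0.
have s_gt0 : 0 < s by rewrite normr_gt0 mulf_neq0.
have pq_neq0 : p + q != 0.
  rewrite -dot_gt0 dotDl !dotDr pq (dotC q p) pq addr0 add0r pp qq.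
  by rewrite ltr_wpDr // normr_ge0.
apply: le_trans (root_conv_factor_le_worst M pq_neq0).
rewrite (root_conv_factor_two_modes a_neq1 b_neq1 Mp Mq pq pq_neq0) pp qq.
by rewrite two_mode_factor_balanced// sqrtr_sqr ger0_norm//.
Qed.

(** For [a != b], Cayley-Hamilton makes [(M - b) v] and [(M - a) v]
eigenvectors, and [v] is their difference divided by [a - b].  For [a = b] it
gives [(M - a)^2 = 0], so [(M - a) v] has norm 0 by symmetry: [v] itself is an
eigenvector and the other mode is zero. *)
Lemma two_mode_splitting (R : realType) (M : 'M[R]_2) (a b : R) :
    M^T = M -> char_poly M = ('X - a%:P) * ('X - b%:P) ->
  forall v, exists p q,
    [/\ v = p + q, M *m p = a *: p, M *m q = b *: q & dot p q = 0].
Proof.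
move=> M_sym chiM v.
have annih : (M - a%:M) *m (M - b%:M) = 0.
  have := Cayley_Hamilton M.
  by rewrite chiM rmorphM !rmorphB /= !horner_mx_X !horner_mx_C.
have annihC : (M - b%:M) *m (M - a%:M) = 0.
  have := Cayley_Hamilton M.
  by rewrite chiM mulrC rmorphM !rmorphB /= !horner_mx_X !horner_mx_C.
have eigP (c : R) (w : 'cV[R]_2) : (M - c%:M) *m w = 0 -> M *m w = c *: w.
  by move/eqP; rewrite mulmxBl mul_scalar_mx subr_eq0 => /eqP.
have [ab|ab] := eqVneq a b.
  exists v, 0; split; rewrite ?addr0 ?mulmx0 ?scaler0//; last first.
    by rewrite dotE mulmx0 mxE.
  apply: eigP; apply/eqP; rewrite -dot_eq0 dot_mulmxl.
    by rewrite mulmxA {2}ab annih mul0mx dotE mulmx0 mxE.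
  by rewrite linearB /= M_sym tr_scalar_mx.
pose p := (a - b)^-1 *: ((M - b%:M) *m v).
pose q := - (a - b)^-1 *: ((M - a%:M) *m v).
have Mp : M *m p = a *: p.
  by apply: eigP; rewrite -scalemxAr mulmxA annih mul0mx scaler0.
have Mq : M *m q = b *: q.
  by apply: eigP; rewrite -scalemxAr mulmxA annihC mul0mx scaler0.
exists p, q; split=> //; last exact: eigenvector_orthogonal M_sym ab Mp Mq.
have AB : (M - b%:M) - (M - a%:M) = (a - b)%:M.
  by rewrite opprB addrC addrA subrK raddfB.
rewrite /p /q scaleNr -scalerBr -mulmxBl AB mul_scalar_mx scalerA.
by rewrite mulVf ?subr_eq0// scale1r.
Qed.

Theorem theorem4p5 (R : realType) (n : nat) (n_ge2 : (2 <= n)%N)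
    (M : 'M[R]_n) (m : 'I_n -> R)
    (M_sym : M^T = M) (M_neq0 : M != 0) (m_eig : eigenvalues_of M m)
    (A_inv : 1%:M - M \in unitmx) :
  ((max_pair_factor m)%:E <= worst_root_conv_factor M)%E /\
  (n = 2%N -> worst_root_conv_factor M = (max_pair_factor m)%:E).
Proof.
have lower : ((max_pair_factor m)%:E <= worst_root_conv_factor M)%E.
  rewrite /max_pair_factor.
  have pair_le i j := pair_factor_le_worst i j M_sym m_eig A_inv.
  (* The default value 0 of the maximum lies below any pair factor, even one
     with equal indices. *)
  apply: (big_ind (fun x => x%:E <= worst_root_conv_factor M)%E) => //.
  - pose i : 'I_n := Ordinal (ltnW n_ge2).
    by apply: le_trans (pair_le i i); rewrite lee_fin sqrtr_ge0.
  - by move=> x y xM yM; rewrite /Num.max; case: ifP.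
split=> // n2; subst n; apply/eqP; rewrite eq_le lower andbT.
apply: ge_ereal_sup => _ [r /= r_neq0 <-].
pose i : 'I_2 := ord0; pose j : 'I_2 := lift ord0 ord0.
have chiM : char_poly M = ('X - (m i)%:P) * ('X - (m j)%:P).
  by rewrite m_eig !big_ord_recl big_ord0 mulr1.
have a_neq1 := eigenvalue_neq1 M_sym m_eig i A_inv.
have b_neq1 := eigenvalue_neq1 M_sym m_eig j A_inv.
have [p [q [rE Mp Mq pq]]] := two_mode_splitting M_sym chiM r.
rewrite rE in r_neq0 *.
rewrite (root_conv_factor_two_modes a_neq1 b_neq1 Mp Mq pq r_neq0) lee_fin.
apply: (@le_trans _ _ (pair_factor (m i) (m j))).
  rewrite ler_wsqrtr//.
  have Q_ge0 : 0 <= `|m i * m j * (m j - m i)| /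
      (`|m i * (m i - 1)| + `|m j * (m j - 1)|) by rewrite divr_ge0 ?addr_ge0.
  rewrite -(ger0_norm Q_ge0) -sqrtr_sqr ler_wsqrtr//.
  by rewrite two_mode_factor_le ?dot_ge0.
by apply: (le_bigmax_cond _ (j := (i, j))).
Qed.
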